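(* Let $\alpha>0$ and let $w:\mathbb{R}\to(0,\infty)$ be a measurable function. For $\mathbb{P}\in\mathcal{P}_{(0,1)}$ define $$\widetilde{\mathbb{P}}^*(x):=\left(1+\left(\frac{1-\mathbb{P}(x)}{\mathbb{P}(x)}\right)^{\frac{1}{2\alpha}}\right)^{-1},\qquad x\in\mathbb{R}.$$ Then $\mathbb{P}\mapsto\widetilde{\mathbb{P}}^*$ is a mapping from $\mathcal{P}_{(0,1)}$ to $\mathcal{P}_{(0,1)}$, and the function $\widetilde{S}^*_{\alpha,w}:\mathcal{P}_{(0,1)}\times\mathbb{R}\to[0,\infty]$ given by $$\widetilde{S}^*_{\alpha,w}(\mathbb{P},y):=\widetilde{S}_{\alpha,w}(\widetilde{\mathbb{P}}^*,y),\qquad \mathbb{P}\in\mathcal{P}_{(0,1)},\ y\in\mathbb{R},$$ is a proper scoring rule relative to $\mathcal{P}_{(0,1)}$. Further, for any $\mathbb{P}\in\mathcal{P}_{(0,1)}$ and $y\in\mathbb{R}$, $$\widetilde{S}_{\alpha,w}(\widetilde{\mathbb{P}}^*,y)=\int_{\mathbb{R}}\frac{\left|\mathbf{1}_{(y,\infty)}(x)-\mathbb{P}(x)\right|^{\frac12}}{\left|1-\mathbf{1}_{(y,\infty)}(x)-\mathbb{P}(x)\right|^{\frac12}}\,w(x)\,\mathrm{d}x,$$ and $$\widetilde{S}_{\alpha,w}(\widetilde{\mathbb{P}}^*,\mathbb{P})=\int_{\mathbb{R}}\widetilde{S}_{\alpha,w}(\widetilde{\mathbb{P}}^*,y)\,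\mathbb{P}(\mathrm{d}y)=2\int_{\mathbb{R}}\big(\mathbb{P}(x)(1-\mathbb{P}(x))\big)^{\frac12}w(x)\,\mathrm{d}x.$$
   Context: A probability measure $\mathbb{P}$ on $(\mathbb{R},\mathcal{B}(\mathbb{R}))$ (Borel $\sigma$-algebra) is identified with its distribution function in the left-continuous convention: $\mathbb{P}(x):=\mathbb{P}((-\infty,x))$, $x\in\mathbb{R}$. $\mathcal{P}_{(0,1)}$ denotes the (convex) set of those probability measures on $(\mathbb{R},\mathcal{B}(\mathbb{R}))$ whose distribution function takes values in the open interval $(0,1)$, i.e. $0<\mathbb{P}(x)<1$ for all $x\in\mathbb{R}$. For a convex set $\mathcal{P}$ of probability measures on $(\mathbb{R},\mathcal{B}(\mathbb{R}))$, a scoring rule is a function $S:\mathcal{P}\times\mathbb{R}\to\mathbb{R}\cup\{-\infty,\infty\}$ such that $S(\mathbb{P},\mathbb{Q}):=\int_{\mathbb{R}}S(\mathbb{P},\omega)\,\mathbb{Q}(\mathrm{d}\omega)$ is well-defined (possibly infinite) for all $\mathbb{P},\mathbb{Q}\in\mathcal{P}$; in particular $\omega\mapsto S(\mathbb{P},\omega)$ is measurable for every $\mathbb{P}\in\mathcal{P}$. A scoring rule $S$ is proper relative to $\mathcal{P}$ if $S(\mathbb{Q},\mathbb{Q})\le S(\mathbb{P},\mathbb{Q})$ for all $\mathbb{P},\mathbb{Q}\in\mathcal{P}$. For $\alpha>0$ and measurable $w:\mathbb{R}\to(0,\infty)$, the function $\widetilde{S}_{\alpha,w}:\mathcal{P}_{(0,1)}\times\mathbb{R}\to[0,\infty]$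 is defined by $$\widetilde{S}_{\alpha,w}(\mathbb{P},y):=\int_{\mathbb{R}}\frac{|\mathbb{P}(x)-\mathbf{1}_{\{y<x\}}|^{2\alpha}}{\mathbb{P}(x)^\alpha(1-\mathbb{P}(x))^\alpha}\,w(x)\,\mathrm{d}x,\qquad \mathbb{P}\in\mathcal{P}_{(0,1)},\ y\in\mathbb{R},$$ and $\widetilde{S}_{\alpha,w}(\mathbb{P},\mathbb{Q}):=\int_{\mathbb{R}}\widetilde{S}_{\alpha,w}(\mathbb{P},y)\,\mathbb{Q}(\mathrm{d}y)$. Here $\mathbf{1}$ denotes an indicator function. *)

(* Defs.v *)
From HB Require Import structures.
From mathcomp Require Import all_boot all_order all_algebra.
From mathcomp Require Import all_classical all_reals all_analysis.
From mathcomp Require Import measurable_realfun.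
Set Implicit Arguments.
Unset Strict Implicit.
Unset Printing Implicit Defensive.
Import Order.TTheory GRing.Theory Num.Theory.
Import numFieldNormedType.Exports.
Local Open Scope classical_set_scope.
Local Open Scope ring_scope.

(* Left-continuous convention, unlike the library's [cdf]. *)
Definition distr_fun (R : realType) (P : probability (measurableTypeR R) R)
  (x : R) : R := fine (P `]-oo, x[%classic).

Definition P01 (R : realType) : set (probability (measurableTypeR R) R) :=
  [set P | forall x : R, 0 < distr_fun P x < 1].
Arguments P01 : clear implicits.

Definition convex_class (R : realType)
    (C : set (probability (measurableTypeR R) R)) : Prop :=
  forall P Q, C P -> C Q -> forall t : R, 0 <= t <= 1 ->
  exists2 M, C M & forall A : set (measurableTypeR R), measurable A ->
    M A = (t%:E * P A + (1 - t)%:E * Q A)%E.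

Definition expected_score (R : realType)
    (S : probability (measurableTypeR R) R -> R -> \bar R)
    (P Q : probability (measurableTypeR R) R) : \bar R :=
  (\int[Q]_y S P y)%E.

(* The library's integral is total, so its being well-defined in
   [-oo, +oo] has to be required: the integrals of the positive and negative
   parts are not both infinite. *)
Definition well_defined_integral (R : realType)
    (Q : probability (measurableTypeR R) R) (f : measurableTypeR R -> \bar R)
    : Prop :=
  measurable_fun [set: measurableTypeR R] f /\
  (\int[Q]_y (f ^\+ y) < +oo \/ \int[Q]_y (f ^\- y) < +oo)%E.

(* Functions on C x R are represented by functions defined for all P; only
   their values for P in C matter. *)
Definition scoring_rule (R : realType)
    (C : set (probability (measurableTypeR R) R))
    (S : probability (measurableTypeR R) R -> R -> \bar R) : Prop :=
  convex_class C /\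
  forall P Q, C P -> C Q -> well_defined_integral Q (S P).

Definition proper_scoring_rule (R : realType)
    (C : set (probability (measurableTypeR R) R))
    (S : probability (measurableTypeR R) R -> R -> \bar R) : Prop :=
  scoring_rule C S /\
  forall P Q, C P -> C Q -> (expected_score S Q Q <= expected_score S P Q)%E.

Definition score (R : realType) (alpha : R) (w : R -> R)
    (P : probability (measurableTypeR R) R) (y : R) : \bar R :=
  (\int[@lebesgue_measure R]_x
    (`|distr_fun P x - (y < x)%R%:R| `^ (2 * alpha)
     / (distr_fun P x `^ alpha * (1 - distr_fun P x) `^ alpha) * w x)%:E)%E.

Definition star_fun (R : realType) (alpha : R)
    (P : probability (measurableTypeR R) R) (x : R) : R :=
  (1 + ((1 - distr_fun P x) / distr_fun P x) `^ (1 / (2 * alpha)))^-1.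

(* A probability measure whose distribution function is [star_fun alpha P];
   the default P is taken if there is none. *)
Definition star (R : realType) (alpha : R)
    (P : probability (measurableTypeR R) R)
    : probability (measurableTypeR R) R :=
  xget P [set Q | forall x, distr_fun Q x = star_fun alpha P x].

Definition score_star (R : realType) (alpha : R) (w : R -> R)
    (P : probability (measurableTypeR R) R) (y : R) : \bar R :=
  score alpha w (star alpha P) y.

(* Main.v *)
Require Import Defs.
From HB Require Import structures.
From mathcomp Require Import all_boot all_order all_algebra.
From mathcomp Require Import all_classical all_reals all_analysis.
From mathcomp Require Import measurable_realfun.
From mathcomp Require Import ring lra.
Import Order.TTheory GRing.Theory Num.Theory.
Import numFieldNormedType.Exports.
Local Open Scope classical_set_scope.
Local Open Scope ring_scope.

(* On (0,1) the distribution function of the transformed measure is F' =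
   phi(F) with phi u = (1 + ((1 - u) / u)^c)^-1 and c = 1 / (2 alpha).  As phi
   is increasing and continuous with limits 0 and 1, the Stieltjes measure of
   phi applied to the right-continuous cdf has F' as its left-continuous
   distribution function.
   Since (1 - F') / F' = ((1 - F) / F)^c, the integrand of the score reduces
   to sqrt((1 - F) / F) for y < x and to its inverse for y >= x.  By Tonelli,
   the expected score under a measure with distribution function G is
     int (G sqrt((1 - F) / F) + (1 - G) sqrt(F / (1 - F))) w,
   and the AM-GM inequality shows that the integrand is minimal at F = G, where
   it is 2 sqrt(G (1 - G)) w. *)

(** * Odds against, and the map phi on the open unit interval *)

Definition codds {R : realType} (u : R) : R := (1 - u) / u.

Definition star_map {R : realType} (c u : R) : R := (1 + codds u `^ c)^-1.

Lemma codds_gt0 (R : realType) (u : R) : 0 < u < 1 -> 0 < codds u.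
Proof. by case/andP=> u0 u1; rewrite divr_gt0// subr_gt0. Qed.

Lemma codds_le (R : realType) (u v : R) :
  0 < u -> 0 < v -> u <= v -> codds v <= codds u.
Proof.
move=> u0 v0 uv.
by rewrite /codds !mulrBl !mul1r !divff ?gt_eqF// lerD2r lef_pV2.
Qed.

Lemma powRV (R : realType) (x c : R) : 0 <= x -> x^-1 `^ c = (x `^ c)^-1.
Proof. by move=> x0; rewrite -(powR_inv1 x0) powRAC powR_inv1 ?powR_ge0. Qed.

Lemma star_map_itv (R : realType) (c u : R) :
  0 < u < 1 -> 0 < star_map c u < 1.
Proof.
move=> /codds_gt0/powR_gt0-/(_ c) o0; rewrite /star_map invr_gt0 addr_gt0//=.
by rewrite invf_lt1 ?ltrDl// addr_gt0.
Qed.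

(** The inverse of [codds] is o -> (1 + o)^-1, so [star_map c] is the c-th power map read through
    the odds. *)
Lemma codds_star_map (R : realType) (c u : R) :
  0 < u < 1 -> codds (star_map c u) = codds u `^ c.
Proof.
move=> /codds_gt0/powR_gt0-/(_ c) o0.
rewrite /star_map {1}/codds invrK mulrBl mul1r.
by rewrite mulVf ?gt_eqF ?addr_gt0// addrC addKr.
Qed.

Lemma star_map_le (R : realType) (c u v : R) :
  0 <= c -> 0 < u < 1 -> 0 < v < 1 -> u <= v -> star_map c u <= star_map c v.
Proof.
move=> c0 u01 v01 uv; have /andP[u0 u1] := u01; have /andP[v0 v1] := v01.
have ou := powR_gt0 c (codds_gt0 _ _ u01).
have ov := powR_gt0 c (codds_gt0 _ _ v01).
rewrite /star_map lef_pV2 ?posrE ?addr_gt0// lerD2l ge0_ler_powR//.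
- by rewrite nnegrE ltW// codds_gt0.
- by rewrite nnegrE ltW// codds_gt0.
- exact: codds_le.
Qed.

Lemma cvg_powR (R : realType) (c u : R) : 0 < u -> x `^ c @[x --> u] --> u `^ c.
Proof.
move=> u0; have : {for u, continuous (@powR R ^~ c)}; last by [].
apply/differentiable_continuous/derivable1_diffP.
by apply: derivable_powR; rewrite in_itv/= u0.
Qed.

Lemma cvg_star_map (R : realType) (c u : R) : 0 < u < 1 ->
  star_map c x @[x --> u] --> star_map c u.
Proof.
move=> u01; have /andP[u0 u1] := u01.
apply: cvgV.
  by rewrite gt_eqF// addr_gt0// powR_gt0// codds_gt0.
apply: cvgD; first exact: cvg_cst.
have co : codds x @[x --> u] --> codds u.
  apply: cvgM; last by apply: cvgV; [rewrite gt_eqF|exact: cvg_id].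
  by apply: cvgB; [exact: cvg_cst|exact: cvg_id].
exact: (cvg_comp _ _ co (cvg_powR _ c _ (codds_gt0 _ _ u01))).
Qed.

(** Exchanging u and 1 - u inverts the odds, and inversion commutes with powers. The symmetry
    carries the limit at 1, where the odds vanish, over to 0, where they blow up. *)
Lemma star_map_flip (R : realType) (c u : R) :
  0 < u < 1 -> star_map c (1 - u) = 1 - star_map c u.
Proof.
move=> u01; have o0 := codds_gt0 _ _ u01; have p0 := powR_gt0 c o0.
have -> : star_map c (1 - u) = (1 + (codds u `^ c)^-1)^-1.
  rewrite /star_map; congr (1 + _)^-1.
  rewrite -powRV ?ltW//; congr (_ `^ c).
  by rewrite /codds subKr invfM invrK mulrC.
by rewrite /star_map; field; rewrite !gt_eqF//= addr_gt0.
Qed.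

Lemma cvg_powR0 (R : realType) (c : R) (T : Type) (F : set_system T)
    (FF : Filter F) (h : T -> R) : 0 < c -> (forall t, 0 < h t) ->
  h t @[t --> F] --> (0 : R) -> h t `^ c @[t --> F] --> (0 : R).
Proof.
(* [powR_cvg0] is a limit from the right; positivity of [h] turns convergence to 0 into convergence
   to 0 from the right. *)
move=> c0 h_gt0 h0; apply: (@cvg_comp _ _ _ h (@powR R ^~ c) F (0 : R)^'+).
  move=> A /h0 hA; have : F [set t | 0 < h t -> A (h t)] := hA.
  by apply: (@filterS _ F) => t /(_ (h_gt0 t)).
exact: powR_cvg0.
Qed.

Lemma cvg_star_map1 (R : realType) (c : R) (T : Type) (F : set_system T)
    (FF : Filter F) (h : T -> R) : 0 < c -> (forall t, 0 < h t < 1) ->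
  h t @[t --> F] --> (1 : R) -> star_map c (h t) @[t --> F] --> (1 : R).
Proof.
move=> c0 h01 h1.
have oh : codds (h t) @[t --> F] --> (0 : R).
  rewrite -[X in _ --> X](mul0r (1 : R)^-1) -[X in X / _](subrr (1 : R)).
  apply: cvgM; last by apply: cvgV => //; rewrite oner_eq0.
  by apply: cvgB => //; exact: cvg_cst.
suff : star_map c (h t) @[t --> F] --> ((1 : R) + 0)^-1 by rewrite addr0 invr1.
apply: cvgV; first by rewrite addr0 oner_eq0.
apply: cvgD; first exact: cvg_cst.
by apply: cvg_powR0 => // t; exact: codds_gt0.
Qed.

Lemma cvg_star_map0 (R : realType) (c : R) (T : Type) (F : set_system T)
    (FF : Filter F) (h : T -> R) : 0 < c -> (forall t, 0 < h t < 1) ->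
  h t @[t --> F] --> (0 : R) -> star_map c (h t) @[t --> F] --> (0 : R).
Proof.
move=> c0 h01 h0.
have h01' t : 0 < 1 - h t < 1.
  by have /andP[? ?] := h01 t; rewrite subr_gt0 ltrBlDr ltrDl; apply/andP.
have -> : (fun t => star_map c (h t)) = (fun t => 1 - star_map c (1 - h t)).
  by apply/funext => t; rewrite star_map_flip// subKr.
rewrite -[X in _ --> X](subrr (1 : R)); apply: cvgB; first exact: cvg_cst.
apply: cvg_star_map1 => //; rewrite -[X in _ --> X](subr0 (1 : R)).
by apply: cvgB => //; exact: cvg_cst.
Qed.

(** * Distribution functions and existence of the transformed measure *)

(** Continuity from below along closed half-lines; it links the right-continuous [cdf] to the
    left-continuous [distr_fun]. *)
Lemma cvg_distr_left (R : realType) (P : probability (measurableTypeR R) R)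
    (x : R) :
  P `]-oo, x - n.+1%:R^-1]%classic @[n --> \oo] --> P `]-oo, x[%classic.
Proof.
have -> : `]-oo, x[%classic = \bigcup_n `]-oo, x - n.+1%:R^-1]%classic.
  apply/seteqP; split=> [y|y [n _]]/=; rewrite !in_itv/=.
    move=> /ltr_add_invr[n ynx]; exists n => //=.
    by rewrite in_itv/= lerBrDr ltW.
  by move=> /le_lt_trans; apply; rewrite ltrBlDr ltrDl.
apply: nondecreasing_cvg_mu => //.
  exact: bigcup_measurable.
move=> m n mn; apply/subsetPset; apply: subset_itvl.
by rewrite bnd_simp lerD2l lerN2 lef_pV2 ?posrE// ler_nat.
Qed.

Lemma nondecreasing_distr_fun (R : realType)
    (P : probability (measurableTypeR R) R) :
  {homo distr_fun P : x y / x <= y}.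
Proof.
move=> x y xy; rewrite fine_le ?fin_num_measure// le_measure ?inE//.
exact: subset_itvl.
Qed.

Lemma measurable_distr_fun (R : realType)
    (P : probability (measurableTypeR R) R) :
  measurable_fun [set: measurableTypeR R] (distr_fun P : measurableTypeR R -> R).
Proof. exact: nondecreasing_measurable (nondecreasing_distr_fun _ P). Qed.

Lemma distr_funE (R : realType) (P : probability (measurableTypeR R) R)
    (x : R) :
  P `]-oo, x[%classic = (distr_fun P x)%:E.
Proof. by rewrite fineK ?fin_num_measure. Qed.

Lemma ex_distr_fun_star (R : realType) (alpha : R)
    (P : probability (measurableTypeR R) R) : 0 < alpha -> P01 R P ->
  exists Q : probability (measurableTypeR R) R,
    forall x, distr_fun Q x = star_fun alpha P x.
Proof.
move=> alpha0 P01P; set c : R := 1 / (2 * alpha).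
have c0 : 0 < c by rewrite divr_gt0// mulr_gt0.
(* [cdf] takes a random variable, so [P] is seen as the law of the identity. *)
pose idR : measurableTypeR R -> R := idfun.
pose X : {RV P >-> R} := HB.pack idR
  (@isMeasurableFun.Build _ _ _ _ idR (@measurable_id _ _ setT)).
pose F x : R := fine (cdf X x).
have FE x : cdf X x = (F x)%:E by rewrite fineK ?fin_num_measure.
have PE x : P `]-oo, x]%classic = (F x)%:E by rewrite -FE.
have F01 x : 0 < F x < 1.
  (* The half-line closed at x lies between the open ones ending at x and at x + 1; any positive
     shift would do. *)
  have /andP[lb _] := P01P x; have /andP[_ ub] := P01P (x + 1).
  apply/andP; split; [apply: lt_le_trans lb _|apply: le_lt_trans ub].
    rewrite -lee_fin -(distr_funE _ P) -PE le_measure ?inE//.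
    by apply: subset_itvl; rewrite bnd_simp.
  rewrite -lee_fin -(distr_funE _ P) -PE le_measure ?inE//; apply: subset_itvl.
  by rewrite bnd_simp ltrDl.
pose G x : R := star_map c (F x).
have Gnd : {homo G : x y / x <= y}.
  move=> x y xy; apply: star_map_le => //; first exact: ltW.
  by rewrite -lee_fin -!FE; exact: cdf_nondecreasing.
have Grc x : G t @[t --> x^'+] --> G x.
  apply: (cvg_comp F (star_map c)); last exact: cvg_star_map.
  by apply: fine_cvg; rewrite -FE; exact: cdf_right_continuous.
have GNy : G @ -oo --> (0 : R).
  by apply: cvg_star_map0 => //; exact/fine_cvg/cvg_cdfNy0.
have Gy : G @ +oo --> (1 : R).
  by apply: cvg_star_map1 => //; exact/fine_cvg/cvg_cdfy1.
pose f : cumulativeBounded (0 : R) (1 : R) := HB.pack G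
  (isCumulative.Build R _ R G Gnd Grc)
  (isCumulativeBounded.Build R 0 1 G GNy Gy).
pose Q : probability (measurableTypeR R) R := lebesgue_stieltjes_measure f.
have QE x : Q `]-oo, x]%classic = (G x)%:E.
  exact: (cdf_lebesgue_stieltjes_id f x).
exists Q => x.
(* The values of [Q] on the half-lines closed at x - 1/(n+1) tend to its value on the open half-line
   at x and, by continuity of [star_map c], to the wanted value; limits are unique. *)
have : (G (x - n.+1%:R^-1))%:E @[n --> \oo] --> (star_map c (distr_fun P x))%:E.
  apply: cvg_EFin; first exact: nearW.
  apply: (cvg_comp (fun n => F (x - n.+1%:R^-1)) (star_map c));
    last exact: cvg_star_map.
  apply: fine_cvg; rewrite fineK ?fin_num_measure//.
  exact: cvg_distr_left.
have := cvg_distr_left _ Q x; under eq_fun do rewrite QE.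
move=> /cvg_unique => /(_ (@ereal_hausdorff _)) /[apply].
by rewrite /distr_fun => ->.
Qed.

Lemma distr_fun_star (R : realType) (alpha : R)
    (P : probability (measurableTypeR R) R) : 0 < alpha -> P01 R P ->
  forall x, distr_fun (star alpha P) x = star_fun alpha P x.
Proof.
move=> alpha0 /(ex_distr_fun_star _ _ _ alpha0)[Q QE].
(* A suitable measure exists, so [xget] picks one rather than its default [P]. *)
by apply: (@xgetPex _ P [set Q | forall x, distr_fun Q x = _]); exists Q.
Qed.

Lemma P01_star (R : realType) (alpha : R)
    (P : probability (measurableTypeR R) R) :
  0 < alpha -> P01 R P -> P01 R (star alpha P).
Proof.
by move=> alpha0 P01P x; rewrite distr_fun_star//; exact: star_map_itv.
Qed.

(** * Convexity of the class *)

(** The mixture already has mass 1; normalizing serves only to give it the type of a probability. *)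
Lemma mnormalize_setT1 d (T : measurableType d) (R : realType)
    (mu : {measure set T -> \bar R}) (P : probability T R) (A : set T) :
  mu setT = 1%E -> mnormalize mu P A = mu A.
Proof. by move=> mu1; rewrite /mnormalize mu1 onee_eq0/= invr1 mule1. Qed.

Lemma convex_P01 (R : realType) : convex_class (P01 R).
Proof.
move=> P Q P01P P01Q t /andP[t0 t1].
have t1' : 0 <= 1 - t by rewrite subr_ge0.
pose m := measure_add (mscale (NngNum t0) P) (mscale (NngNum t1') Q).
have mE A : m A = (t%:E * P A + (1 - t)%:E * Q A)%E by exact: measure_addE.
have mT : m setT = 1%E.
  by rewrite mE (probability_setT P) (probability_setT Q) !mule1 -EFinD subrKC.
pose M : probability (measurableTypeR R) R := mnormalize m P.
have ME A : M A = (t%:E * P A + (1 - t)%:E * Q A)%E.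
  by rewrite -mE; exact: mnormalize_setT1.
exists M => // x; rewrite /distr_fun ME.
have /andP[a0 a1] := P01P x; have /andP[b0 b1] := P01Q x.
rewrite !distr_funE -!EFinM -EFinD/=.
(* For t > 0 the contribution of [P] alone makes both bounds strict; for t = 0 only [Q] remains. *)
have [->|tn0] := eqVneq t 0; first by rewrite mul0r add0r subr0 mul1r b0.
have t_gt0 : 0 < t by rewrite lt_def tn0.
by apply/andP; split; nra.
Qed.

(** * Reduction of the score to square roots of odds *)

Lemma powR_div (R : realType) (x y c : R) :
  0 <= x -> 0 <= y -> (x / y) `^ c = x `^ c / y `^ c.
Proof. by move=> x0 y0; rewrite powRM ?invr_ge0// powRV. Qed.

Lemma powR2 (R : realType) (x c : R) : 0 <= x -> x `^ (2 * c) = (x `^ c) ^+ 2.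
Proof. by move=> x0; rewrite mulrC powRrM powR_mulrn ?powR_ge0. Qed.

(** The quotient is [codds v] to the power alpha if [b] holds, and its inverse otherwise. As
    [codds v] is [codds u] to the power 1 / (2 alpha), alpha cancels and the exponent 1/2
    remains. *)
Lemma score_integrand (R : realType) (alpha u : R) (b : bool) :
  let v := star_map (1 / (2 * alpha)) u in
  0 < alpha -> 0 < u < 1 ->
  `|v - b%:R| `^ (2 * alpha) / (v `^ alpha * (1 - v) `^ alpha) =
  if b then codds u `^ (1 / 2) else (codds u)^-1 `^ (1 / 2).
Proof.
move=> v alpha0 u01; have o0 := codds_gt0 _ _ u01.
have /andP[v0 v1] : 0 < v < 1 by exact: star_map_itv.
have v1' : 0 < 1 - v by rewrite subr_gt0.
have a0 := powR_gt0 alpha v0; have b0 := powR_gt0 alpha v1'.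
have vE : (1 - v) `^ alpha / v `^ alpha = codds u `^ (1 / 2).
  rewrite -powR_div ?ltW// -/(codds v) codds_star_map// -powRrM.
  by congr (_ `^ _); field; rewrite gt_eqF.
case: b => /=.
  rewrite distrC ger0_norm ?ltW// powR2 ?ltW// -vE.
  by field; rewrite !gt_eqF.
rewrite subr0 ger0_norm ?ltW// powR2 ?ltW//.
rewrite powRV ?(ltW o0)// -vE.
by field; rewrite !gt_eqF.
Qed.

Lemma score_starE (R : realType) (alpha : R) (w : R -> R)
    (P : probability (measurableTypeR R) R) (y : R) :
  0 < alpha -> P01 R P ->
  score alpha w (star alpha P) y = (\int[@lebesgue_measure R]_x
    (if (y < x)%R then codds (distr_fun P x) `^ (1 / 2) * w x
     else (codds (distr_fun P x))^-1 `^ (1 / 2) * w x)%:E)%E.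
Proof.
move=> alpha0 P01P; apply: eq_integral => x _; congr EFin.
by rewrite distr_fun_star// [X in X * _]score_integrand//; case: ifP.
Qed.

(** * Tonelli for integrands that switch at a threshold *)

Section fubini_threshold.
Context {R : realType} (A B : measurableTypeR R -> R).
Hypotheses (mA : measurable_fun setT A) (mB : measurable_fun setT B).
Hypotheses (A0 : forall x, 0 <= A x) (B0 : forall x, 0 <= B x).

Let h (z : measurableTypeR R * measurableTypeR R) : \bar R :=
  (if (z.1 : R) < z.2 then A z.2 else B z.2)%:E.

Let h_ge0 z : (0 <= h z)%E.
Proof. by rewrite lee_fin; case: ifP. Qed.

Let measurable_h : measurable_fun setT h.
Proof.
apply/measurable_EFinP; apply: measurable_fun_ifT.
- exact: measurable_fun_ltr.
- exact: measurableT_comp.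
- exact: measurableT_comp.
Qed.

Lemma measurable_threshold_integral : measurable_fun setT
  (fun y : measurableTypeR R =>
    \int[@lebesgue_measure R]_x (if (y < x)%R then A x else B x)%:E)%E.
Proof. exact: (@measurable_fun_fubini_tonelli_F _ _ _ _ _ _ h). Qed.

Lemma integral_threshold (Q : probability (measurableTypeR R) R) :
  (\int[Q]_y \int[@lebesgue_measure R]_x (if (y < x)%R then A x else B x)%:E =
   \int[@lebesgue_measure R]_x
     (distr_fun Q x * A x + (1 - distr_fun Q x) * B x)%:E)%E.
Proof.
rewrite (@fubini_tonelli _ _ _ _ _ Q (@lebesgue_measure R) h)//.
apply: eq_integral => x _.
(* For fixed x the switch y < x selects exactly the open half-line measured by [distr_fun Q x]: the
   left-continuous convention matches the strict inequality. *)
transitivity (\int[Q]_y ((A x)%:E * (\1_(`]-oo, x[%classic) y)%:E +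
    (B x)%:E * (\1_(~` `]-oo, x[%classic) y)%:E))%E.
  apply: eq_integral => y _; rewrite /h/= !indicE.
  rewrite in_setC mem_setE in_itv/=.
  by case: ifP => _; rewrite /= !(mule1, mule0, adde0, add0e).
have mI : measurable (`]-oo, x[%classic : set (measurableTypeR R)) by [].
have mIC : measurable (~` `]-oo, x[%classic : set (measurableTypeR R)).
  exact: measurableC.
have QxC : Q (~` `]-oo, x[%classic) = (1 - distr_fun Q x)%:E.
  by rewrite (probability_setC Q mI) distr_funE EFinB.
rewrite ge0_integralD//=.
- rewrite !ge0_integralZl ?lee_fin//.
  + rewrite !integral_indic// !setIT.
    rewrite EFinD !EFinM (muleC _ (A x)%:E) (muleC _ (B x)%:E).
    by congr (_ * _ + _ * _)%E; [exact: distr_funE|exact: QxC].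
  + by apply/measurable_EFinP; exact: measurable_indic.
  + by apply/measurable_EFinP; exact: measurable_indic.
- by move=> y _; rewrite mule_ge0 ?lee_fin.
- by apply/measurable_EFinP/measurable_funM => //; exact: measurable_indic.
- by move=> y _; rewrite mule_ge0 ?lee_fin.
- by apply/measurable_EFinP/measurable_funM => //; exact: measurable_indic.
Qed.

End fubini_threshold.

(** * Measurability of the odds, and the pointwise risk *)

Lemma measurable_codds_distr_fun (R : realType)
    (P : probability (measurableTypeR R) R) (c : R) : P01 R P ->
  measurable_fun [set: measurableTypeR R]
    (fun x : measurableTypeR R => codds (distr_fun P x) `^ c).
Proof.
move=> P01P.
(* The odds of a nondecreasing function are nonincreasing, and monotone functions are measurable. *)
have ni (x y : R) : x <= y -> codds (distr_fun P y) <= codds (distr_fun P x).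
  have /andP[x0 _] := P01P x; have /andP[y0 _] := P01P y.
  by move=> /nondecreasing_distr_fun-/(_ P); exact: codds_le.
have mo : measurable_fun setT
    (fun x : measurableTypeR R => codds (distr_fun P x)).
  exact: nonincreasing_measurable ni.
exact: measurableT_comp (measurable_powR c) mo.
Qed.

Lemma measurable_coddsV_distr_fun (R : realType)
    (P : probability (measurableTypeR R) R) (c : R) : P01 R P ->
  measurable_fun [set: measurableTypeR R]
    (fun x : measurableTypeR R => (codds (distr_fun P x))^-1 `^ c).
Proof.
move=> P01P; rewrite (_ : (fun x => _) =
  fun x => codds (distr_fun P x) `^ (- c)).
  exact: measurable_codds_distr_fun.
by apply/funext => x; rewrite powRV ?powRN// ltW// codds_gt0.
Qed.

(** The expected score density with respect to [w] at a point where the true distribution function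
    is q and the forecast is u. *)
Definition risk {R : realType} (q u : R) : R :=
  q * codds u `^ (1 / 2) + (1 - q) * (codds u)^-1 `^ (1 / 2).

(** With s the square root of [codds q], this and [sqr_sqrt_codds] give sqrt (q (1 - q)) = q s and 1
    - q = q s^2, so that the risk becomes rational in q and s. *)
Lemma sqrt_codds (R : realType) (q : R) :
  0 < q < 1 -> (q * (1 - q)) `^ (1 / 2) = q * codds q `^ (1 / 2).
Proof.
move=> q01; have o0 := codds_gt0 _ _ q01; have /andP[q0 q1] := q01.
have -> : q * (1 - q) = q `^ 2 * codds q.
  by rewrite powR_mulrn ?ltW// /codds; field; rewrite gt_eqF.
rewrite powRM ?powR_ge0 ?ltW// -powRrM; congr (_ * _).
by rewrite -[RHS]powRr1 ?ltW//; congr (_ `^ _); field.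
Qed.

Lemma sqr_sqrt_codds (R : realType) (q : R) :
  0 < q < 1 -> (codds q `^ (1 / 2)) ^+ 2 = codds q.
Proof.
move=> /codds_gt0 o0; rewrite -powR2 ?ltW// -[RHS]powRr1 ?ltW//.
by congr (_ `^ _); field.
Qed.

Lemma risk_diag (R : realType) (q : R) :
  0 < q < 1 -> risk q q = 2 * (q * (1 - q)) `^ (1 / 2).
Proof.
move=> q01; have o0 := codds_gt0 _ _ q01; have /andP[q0 q1] := q01.
rewrite /risk sqrt_codds// powRV ?ltW//.
have := sqr_sqrt_codds _ _ q01.
have : 0 < codds q `^ (1 / 2) by exact: powR_gt0.
move: (codds q `^ (1 / 2)) => s s0 sE.
have -> : 1 - q = q * s ^+ 2 by rewrite sE /codds; field; rewrite gt_eqF.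
by field; rewrite gt_eqF.
Qed.

(** With r and s the square roots of the odds at u and q, the risk at u is q (r + s^2 / r) and the
    one at q is 2 q s; they differ by q (r - s)^2 / r. *)
Lemma risk_min (R : realType) (q u : R) :
  0 < q < 1 -> 0 < u < 1 -> risk q q <= risk q u.
Proof.
move=> q01 /codds_gt0 ou; have o0 := codds_gt0 _ _ q01.
have /andP[q0 q1] := q01.
rewrite risk_diag// sqrt_codds// /risk powRV ?(ltW ou)//.
have := sqr_sqrt_codds _ _ q01.
have : 0 < codds u `^ (1 / 2) by exact: powR_gt0.
move: (codds u `^ (1 / 2)) (codds q `^ (1 / 2)) => r s r0 sE.
have -> : 1 - q = q * s ^+ 2 by rewrite sE /codds; field; rewrite gt_eqF.
rewrite -subr_ge0 (_ : _ - _ = q * (r - s) ^+ 2 / r).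
  exact: divr_ge0 (mulr_ge0 (ltW q0) (sqr_ge0 _)) (ltW r0).
by field; rewrite gt_eqF.
Qed.

(** * Expected scores and propriety *)

Lemma expected_score_star (R : realType) (alpha : R) (w : R -> R)
    (P Q : probability (measurableTypeR R) R) : 0 < alpha ->
  measurable_fun [set: measurableTypeR R] (w : measurableTypeR R -> R) ->
  (forall x, 0 < w x) -> P01 R P ->
  measurable_fun [set: measurableTypeR R]
    (score alpha w (star alpha P) : measurableTypeR R -> \bar R) /\
  (\int[Q]_y score alpha w (star alpha P) y = \int[@lebesgue_measure R]_x
    (risk (distr_fun Q x) (distr_fun P x) * w x)%:E)%E.
Proof.
move=> alpha0 mw w0 P01P.
pose A (x : measurableTypeR R) := codds (distr_fun P x) `^ (1 / 2) * w x.
pose B (x : measurableTypeR R) := (codds (distr_fun P x))^-1 `^ (1 / 2) * w x.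
have mA : measurable_fun setT A.
  by apply: measurable_funM => //; exact: measurable_codds_distr_fun.
have mB : measurable_fun setT B.
  by apply: measurable_funM => //; exact: measurable_coddsV_distr_fun.
have A0 x : 0 <= A x by rewrite mulr_ge0 ?powR_ge0 ?ltW.
have B0 x : 0 <= B x by rewrite mulr_ge0 ?powR_ge0 ?ltW.
have sE : score alpha w (star alpha P) = (fun y =>
    \int[@lebesgue_measure R]_x (if (y < x)%R then A x else B x)%:E)%E.
  by apply/funext => y; exact: score_starE.
rewrite sE; split; first exact: measurable_threshold_integral.
rewrite integral_threshold//; apply: eq_integral => x _; congr EFin.
by rewrite /A /B /risk [RHS]mulrDl !mulrA.
Qed.

Lemma measurable_risk (R : realType)
    (P Q : probability (measurableTypeR R) R) : P01 R P ->
  measurable_fun [set: measurableTypeR R]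
    (fun x : measurableTypeR R => risk (distr_fun Q x) (distr_fun P x)).
Proof.
move=> P01P; have mQ := measurable_distr_fun _ Q.
apply: measurable_funD; apply: measurable_funM => //.
- exact: measurable_codds_distr_fun.
- exact: measurable_funB.
- exact: measurable_coddsV_distr_fun.
Qed.

Lemma score_ge0 (R : realType) (alpha : R) (w : R -> R)
    (P : probability (measurableTypeR R) R) (y : R) :
  (forall x, 0 < w x) -> (0 <= score alpha w P y)%E.
Proof.
move=> w0; apply: integral_ge0 => x _.
rewrite lee_fin; apply: mulr_ge0 (ltW (w0 x)).
by rewrite divr_ge0 ?powR_ge0// mulr_ge0 ?powR_ge0.
Qed.

(** The negative part vanishes, so its integral is finite even when the score has infinite
    expectation. *)
Lemma well_defined_integral_ge0 (R : realType)
    (Q : probability (measurableTypeR R) R) (f : measurableTypeR R -> \bar R) :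
  measurable_fun setT f -> (forall y, 0 <= f y)%E -> well_defined_integral Q f.
Proof.
move=> mf f0; split=> //; right; rewrite integral0_eq ?ltry// => y _.
by rewrite (@ge0_funenegE _ _ setT)// inE.
Qed.

Theorem proposition1p3 (R : realType) (alpha : R) (w : R -> R)
    (alpha_gt0 : 0 < alpha)
    (w_meas : measurable_fun [set: measurableTypeR R] (w : measurableTypeR R -> R))
    (w_gt0 : forall x, 0 < w x) :
  (forall P, P01 R P ->
     P01 R (star alpha P) /\
     forall x, distr_fun (star alpha P) x =
       (1 + ((1 - distr_fun P x) / distr_fun P x) `^ (1 / (2 * alpha)))^-1) /\
  (forall P y, P01 R P -> (0 <= score_star alpha w P y)%E) /\
  proper_scoring_rule (P01 R) (score_star alpha w) /\
  (forall P y, P01 R P ->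
     score alpha w (star alpha P) y =
     (\int[@lebesgue_measure R]_x
        (`|\1_(`]y, +oo[%classic) x - distr_fun P x| `^ (1 / 2)
         / `|1 - \1_(`]y, +oo[%classic) x - distr_fun P x| `^ (1 / 2)
         * w x)%:E)%E) /\
  (forall P, P01 R P ->
     expected_score (score alpha w) (star alpha P) P =
       (\int[P]_y score alpha w (star alpha P) y)%E /\
     (\int[P]_y score alpha w (star alpha P) y)%E =
       (2%:E * \int[@lebesgue_measure R]_x
          ((distr_fun P x * (1 - distr_fun P x)) `^ (1 / 2) * w x)%:E)%E).
Proof.
have score0 P y : P01 R P -> (0 <= score_star alpha w P y)%E.
  by move=> _; exact: score_ge0.
have Emean P Q := expected_score_star _ alpha w P Q alpha_gt0 w_meas w_gt0.
split; [|split; [exact: score0|split; [split; [split|]|split]]].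
- move=> P P01P; split; first exact: P01_star.
  by move=> x; rewrite distr_fun_star.
- exact: convex_P01.
- move=> P Q P01P _; apply: well_defined_integral_ge0 => [|y].
    by have [] := Emean P Q P01P.
  exact: score0.
- move=> P Q P01P P01Q.
  (* Rewriting with [Emean] directly makes unification unfold and compare
     [star alpha P] and [star alpha Q], which takes forever. *)
  have le_eq (a b a' b' : \bar R) : a = a' -> b = b' -> (a' <= b' -> a <= b)%E.
    by move=> -> ->.
  apply: (le_eq _ _ _ _ (Emean Q Q P01Q).2 (Emean P Q P01P).2).
  have mint P' : P01 R P' -> measurable_fun [set: measurableTypeR R]
      (fun x => (risk (distr_fun Q x) (distr_fun P' x) * w x)%:E).
    move=> P01P'; apply/measurable_EFinP/measurable_funM => //.
    exact: measurable_risk.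
  (* Propriety now follows pointwise from [risk_min]; the closed form on the diagonal shows that the
     smaller integrand is nonnegative. *)
  apply: ge0_le_integral => //.
  + move=> x _; rewrite lee_fin mulr_ge0 ?ltW// risk_diag//.
    have /andP[F0 F1] := P01Q x.
    by rewrite mulr_gt0// powR_gt0// mulr_gt0 ?subr_gt0.
  + exact: mint.
  + exact: mint.
  + by move=> x _; rewrite lee_fin ler_pM2r// risk_min.
- move=> P y P01P; rewrite score_starE//; apply: eq_integral => x _.
  have Fx := P01P x; have /andP[F0 F1] := Fx.
  have F1' : 0 < 1 - distr_fun P x by rewrite subr_gt0.
  (* For y < x the denominator is the root of |1 - 1 - F| = F, which gives the root of the odds;
     otherwise numerator and denominator trade places. *)
  congr EFin; rewrite indicE mem_setE in_itv/= andbT; case: ifP => _ /=.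
    by rewrite subrr sub0r normrN !gtr0_norm// /codds powR_div ?ltW.
  by rewrite sub0r subr0 normrN !gtr0_norm// /codds invf_div powR_div ?ltW.
- move=> P P01P; split=> //.
  have [_ ->] := Emean P P P01P.
  have mF := measurable_distr_fun _ P.
  rewrite -ge0_integralZl//.
  + apply: eq_integral => x _.
    by rewrite risk_diag// -EFinM mulrA.
  + apply/measurable_EFinP/measurable_funM => //.
    apply: (measurableT_comp (measurable_powR (1 / 2))).
    by apply: measurable_funM => //; exact: measurable_funB.
  + by move=> x _; rewrite lee_fin mulr_ge0 ?powR_ge0 ?ltW.
Qed.
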